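(* For each integer $k \ge 16$, there exists a numerical semigroup $S = \langle a_1, \ldots, a_{k+1}\rangle$ with $k+1$ minimal generators such that $\Delta_0(S) \cap [\tfrac{7}{8}k, k] = \{k-1,k\}$.
   Context: A numerical semigroup is a cofinite, additively closed subset $S \subseteq \mathbb{Z}_{\ge 0}$ containing $0$; $\langle a_1,\ldots,a_n\rangle$ denotes the set of all $\mathbb{Z}_{\ge 0}$-linear combinations of $a_1,\ldots,a_n$. For $S$ with minimal generators $a_1,\ldots,a_n$ and $x \in S$, $\mathsf Z(x) = \{z \in \mathbb{Z}_{\ge 0}^n : x = z_1a_1 + \cdots + z_na_n\}$; $\ell_0(z) = |\{i : z_i > 0\}|$; $\mathcal L_0(x) = \{\ell_0(z) : z \in \mathsf Z(x)\} = \{c_1 < \cdots < c_r\}$; $\Delta_0(x) = \{c_i - c_{i-1} : i = 2,\ldots,r\}$; $\Delta_0(S) = \bigcup_{x \in S}\Delta_0(x)$. The interval $[\tfrac{7}{8}k,k]$ is a closed real interval. *)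

(* Defs.v *)
From HB Require Import structures.
From mathcomp Require Import all_boot all_order all_algebra.
From mathcomp Require Import all_classical all_reals.

Set Implicit Arguments.
Unset Strict Implicit.
Unset Printing Implicit Defensive.

Local Open Scope classical_set_scope.

Definition numerical_semigroup (S : set nat) : Prop :=
  [/\ S 0, forall x y, S x -> S y -> S (x + y) & finite_set (~` S)].

(* The semigroup <a_i : i in J>. *)
Definition generated n (a : 'I_n -> nat) (J : {set 'I_n}) : set nat :=
  [set x | exists z : 'I_n -> nat, x = \sum_(i in J) z i * a i].

(* Minimality with respect to inclusion; it forces the a_i to be positive and
   pairwise distinct, so a lists the minimal generating set without
   repetition. *)
Definition minimal_generators (S : set nat) n (a : 'I_n -> nat) : Prop :=
  generated a [set: 'I_n]%SET = S /\
  forall J : {set 'I_n}, J \proper [set: 'I_n]%SET -> generated a J <> S.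

Definition factorizations n (a : 'I_n -> nat) (x : nat) : set ('I_n -> nat) :=
  [set z | x = \sum_(i < n) z i * a i].

Definition ell0 n (z : 'I_n -> nat) : nat := #|[pred i : 'I_n | 0 < z i]|.

Definition L0 n (a : 'I_n -> nat) (x : nat) : set nat :=
  [set ell0 z | z in factorizations a x].

(* Differences of consecutive elements of L0 a x. *)
Definition Delta0 n (a : 'I_n -> nat) (x : nat) : set nat :=
  [set d | exists c c', [/\ L0 a x c, L0 a x c', c < c',
     forall e, L0 a x e -> ~~ (c < e < c') & d = c' - c]].

(* Meant for a listing the minimal generators of S; the value does not depend
   on the order in which they are listed. *)
Definition Delta0_semigroup (S : set nat) n (a : 'I_n -> nat) : set nat :=
  \bigcup_(x in S) Delta0 a x.

(* Main.v *)
Require Import Defs.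
From HB Require Import structures.
From mathcomp Require Import all_boot all_order all_algebra.
From mathcomp Require Import all_classical all_reals.
From mathcomp Require Import zify ring lra.
Import Order.TTheory GRing.Theory Num.Theory.

(** Write k = h + h' with h, h' coprime and close to k/2, and put m = 2^h - 1,
m' = 2^h' - 1 (coprime as well), a0 = 3 m m'.  The generators are a0 together
with two blocks

  A_i  = (h'+1) a0 + (a0+1) m' 2^i     (i < h),
  A'_j =     3  a0 + (a0+1) 2m 2^j     (j < h').

A factorization z a0 + sum u_i A_i + sum v_j A'_j of x has the shape

  x = a0 * cost + (a0+1) * weight,
  cost = z + (h'+1)|u| + 3|v|,   weight = m' V(u) + 2m V(v),

where V(u) = sum u_i 2^i and |u| = sum u_i.  So the weights of two
factorizations of x are congruent modulo a0, and lowering the weight by a0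
releases a0 + 1 units of cost, that is, copies of a0.  By coprimality, V(u) is
then determined modulo m and V(v) modulo m'.

Inside a block, 2 A_i = A_{i+1} + (h'+1) a0 is binary carrying: it shortens a
factorization, leaves V alone and changes the number of generators in use by
little.  Three more moves shorten and have little effect on the number of
generators in use; they lower the weight by a multiple of a0: two tops of each
block go to one bottom of each, and six tops of a block go to three bottoms.
Hence, across a gap c < c' in L0(x)
with c' - c >= 7k/8, one may take both a factorization w with at least c'
generators and one u with at most c to be reduced: all digits below the top are
0 or 1, the tops are at most 5, and one of the two tops is at most 1 (lemma
exists_reduced).  The numbers V of w are congruent to those of u; but w has
nearly all binary digits and u has few.  A binary word of value below m is
the shortest one in its class modulo m (bits_len_min), so the block of w whose
top is at most 1 must be the all-ones word, whose value m is congruent to 0.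
The same comparison in the other block leaves only the all-ones word, or
all-ones plus a rest; in the second case the large amount of a0 released by
dropping the all-ones words can be spent on splitting a digit of the rest, which
produces a factorization with an intermediate number of generators (lemma
reduced_large_full).  Thus a large gap can occur only at the multiples of a0
that are at least the sum of all the generators other than a0
(gap_only_at_zero).

That sum equals c0 a0 for some c0.  Apart from the empty and the all-ones words,
the words of weight divisible by a0 need at least (c0 + 3) a0; the word
5 A_{h-1} + sum A_i over i < h-1, i <> 1, with value 3m, attains this bound and
uses h - 1 generators.  So (c0 + z) a0 has an
intermediate factorization as soon as z >= 3, while for z <= 2 its only
factorizations are (c0 + z) a0 itself and the all-ones one with z copies of a0
(zero_class).  They give the gap k - 1 for z = 0 and k for z = 1, 2. *)

(** * Binary words with unbounded digits *)

Definition mers (h : nat) : nat := (2 ^ h).-1.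
Definition bval (h : nat) (u : nat -> nat) : nat := \sum_(i < h) u i * 2 ^ i.
Definition len (h : nat) (u : nat -> nat) : nat := \sum_(i < h) u i.
Definition supp (h : nat) (u : nat -> nat) : nat := \sum_(i < h) (0 < u i).

Definition update (u : nat -> nat) (i a : nat) : nat -> nat :=
  fun j => if j == i then a else u j.

(** All the exchanges between factorizations used below trade a copies of one
digit for b copies of another one. *)
Definition move (u : nat -> nat) (i a j b : nat) : nat -> nat :=
  update (update u i (u i - a)) j (u j + b).

Lemma sum_update (F : nat -> nat -> nat) h u i a : i < h ->
  \sum_(j < h) F j (update u i a j) + F i (u i) = \sum_(j < h) F j (u j) + F i a.
Proof.
move=> ih; rewrite (bigD1 (Ordinal ih)) //= [in RHS](bigD1 (Ordinal ih)) //=.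
rewrite (eq_bigr (fun j : 'I_h => F j (u j))) => [|j]; first by rewrite /update eqxx; lia.
by rewrite /update -val_eqE /= => /negPf ->.
Qed.

Lemma bval_move h u i a j b : i < h -> j < h -> i != j -> a <= u i ->
  bval h (move u i a j b) + a * 2 ^ i = bval h u + b * 2 ^ j.
Proof.
move=> ih jh ij ai; have ji : (j == i) = false by rewrite eq_sym (negPf ij).
have := sum_update (fun n c => c * 2 ^ n) h u i (u i - a) ih.
have := sum_update (fun n c => c * 2 ^ n) h (update u i (u i - a)) j (u j + b) jh.
rewrite -/(bval h u) /= /move [update u i _ j]/update ji /bval !mulnDl mulnBl.
have : a * 2 ^ i <= u i * 2 ^ i by rewrite leq_mul2r ai orbT.
move: (\sum_(n < h) update (update _ _ _) _ _ _ * _).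
move: (\sum_(n < h) update u _ _ _ * _) (\sum_(n < h) u _ * _).
move: (a * 2 ^ i) (u i * 2 ^ i) (u j * 2 ^ j) (b * 2 ^ j). lia.
Qed.

Lemma len_move h u i a j b : i < h -> j < h -> i != j -> a <= u i ->
  len h (move u i a j b) + a = len h u + b.
Proof.
move=> ih jh ij ai; have ji : (j == i) = false by rewrite eq_sym (negPf ij).
have := sum_update (fun n c => c) h u i (u i - a) ih.
have := sum_update (fun n c => c) h (update u i (u i - a)) j (u j + b) jh.
rewrite /= /move [update u i _ j]/update ji /len.
move: (\sum_(n < h) update (update _ _ _) _ _ _).
move: (\sum_(n < h) update u _ _ _) (\sum_(n < h) u _); lia.
Qed.

Lemma supp_move h u i a j b : i < h -> j < h -> i != j -> a <= u i ->
  supp h (move u i a j b) <= (supp h u).+1 /\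
  supp h u <= (supp h (move u i a j b)).+1.
Proof.
move=> ih jh ij ai; have ji : (j == i) = false by rewrite eq_sym (negPf ij).
have := sum_update (fun n c => nat_of_bool (0 < c)) h u i (u i - a) ih.
have := sum_update (fun n c => nat_of_bool (0 < c)) h (update u i (u i - a)) j (u j + b) jh.
rewrite /= /move [update u i _ j]/update ji /supp.
move: (\sum_(n < h) (0 < update (update _ _ _) _ _ _)).
move: (\sum_(n < h) (0 < update u _ _ _)) (\sum_(n < h) (0 < u _)); lia.
Qed.

Lemma eq_bval h u w : (forall i, i < h -> u i = w i) -> bval h u = bval h w.
Proof. by move=> E; apply: eq_bigr => i _; rewrite E. Qed.
Lemma eq_len h u w : (forall i, i < h -> u i = w i) -> len h u = len h w.
Proof. by move=> E; apply: eq_bigr => i _; rewrite E. Qed.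

Lemma bvalS h u : bval h.+1 u = bval h u + u h * 2 ^ h.
Proof. by rewrite /bval big_ord_recr. Qed.
Lemma lenS h u : len h.+1 u = len h u + u h.
Proof. by rewrite /len big_ord_recr. Qed.
Lemma suppS h u : supp h.+1 u = supp h u + (0 < u h).
Proof. by rewrite /supp big_ord_recr. Qed.

Lemma supp_le h u : supp h u <= h.
Proof. by elim: h => [|h IH]; rewrite ?suppS /supp ?big_ord0 //; rewrite -/(supp h u); lia. Qed.
Lemma supp_len h u : supp h u <= len h u.
Proof. by apply: leq_sum => i _; lia. Qed.

Lemma term_bval h u i : i < h -> u i * 2 ^ i <= bval h u.
Proof. by move=> ih; rewrite /bval (bigD1 (Ordinal ih)) //= leq_addr. Qed.
Lemma term_len h u i : i < h -> u i <= len h u.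
Proof. by move=> ih; rewrite /len (bigD1 (Ordinal ih)) //= leq_addr. Qed.

Lemma mersS h : (mers h).+1 = 2 ^ h.
Proof. by rewrite /mers prednK ?expn_gt0. Qed.

Definition bits h (u : nat -> nat) := forall i, i < h -> u i <= 1.

Lemma bitsW h u : bits h.+1 u -> bits h u.
Proof. by move=> B i ih; apply: B; lia. Qed.

Lemma bval_bits h u : bits h u -> bval h u <= mers h.
Proof.
elim: h => [|h IH] B; first by rewrite /bval big_ord0.
have := IH (bitsW _ _ B); rewrite bvalS; have := B h (ltnSn h).
have := mersS h; have := mersS h.+1; rewrite expnS.
by case: (u h) => [|[|]] //=; lia.
Qed.

Lemma bits_inj h u w : bits h u -> bits h w -> bval h u = bval h w ->
  forall i, i < h -> u i = w i.
Proof.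
elim: h => [//|h IH] Bu Bw.
have lu := bval_bits _ _ (bitsW _ _ Bu); have lw := bval_bits _ _ (bitsW _ _ Bw).
have uh := Bu h (ltnSn h); have wh := Bw h (ltnSn h); have := mersS h.
rewrite !bvalS => mK E.
have uw : u h = w h by case: (u h) (w h) uh wh E => [|[|?]] [|[|?]] //=; lia.
move=> i; rewrite ltnS leq_eqVlt => /orP[/eqP -> //|]; apply: IH => //.
- exact: bitsW.
- exact: bitsW.
- by rewrite uw in E; lia.
Qed.

Lemma bval_ones h : bval h (fun=> 1) = mers h.
Proof.
elim: h => [|h IH]; first by rewrite /bval big_ord0.
by rewrite bvalS IH; have := mersS h; have := mersS h.+1; rewrite expnS; lia.
Qed.
Lemma len_ones h : len h (fun=> 1) = h.
Proof. by rewrite /len sum1_card card_ord. Qed.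

Lemma bval_eq0 h u : bval h u = 0 -> forall i, i < h -> u i = 0.
Proof.
move=> V i ih; have := term_bval h u i ih; rewrite V leqn0 muln_eq0.
by rewrite expn_eq0 /= orbF => /eqP.
Qed.

Lemma bits_supp h u : bits h u -> supp h u = len h u.
Proof.
move=> B; apply: eq_bigr => i _; have := B i (ltn_ord i).
by case: (u i) => [|[|]].
Qed.

Lemma bitsP h u : bits h u \/ exists2 i, i < h & 2 <= u i.
Proof.
case: (boolP [forall i : 'I_h, u i <= 1]) => [/forallP B|/forallPn [i Hi]].
  by left=> i ih; exact: (B (Ordinal ih)).
by right; exists i => //; rewrite ltnNge.
Qed.

Lemma move_bits_ind h (P : (nat -> nat) -> Prop) :
  (forall u, bits h u -> P u) ->
  (forall u i, i < h -> 2 <= u i ->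
     (forall w, len h w < len h u -> P w) -> P u) ->
  forall u, P u.
Proof.
move=> P0 PS u; have [n] := ubnP (len h u); elim: n u => // n IH u lu.
have [B|[i ih ui]] := bitsP h u; first exact: P0.
by apply: (PS u i) => // w lw; apply: IH; lia.
Qed.

(** * Words modulo a Mersenne number *)

(** Modulo 2^h - 1 the carry out of the top digit comes back as the bottom
digit, since 2^h is congruent to 1. *)
Lemma carry_cyclic h u i : 1 < h -> i < h -> 2 <= u i ->
  exists w, [/\ bval h w = bval h u %[mod mers h], (len h w).+1 = len h u & 0 < len h w].
Proof.
move=> h1 ih ui; pose j := if i.+1 == h then 0 else i.+1.
have jh : j < h by rewrite /j; case: (i.+1 =P h) => ? /=; lia.
have ij : i != j by rewrite /j; case: (i.+1 =P h) => ? /=; lia.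
have V := bval_move h u i 2 j 1 ih jh ij ui.
have L := len_move h u i 2 j 1 ih jh ij ui.
have tl := term_len h u i ih.
exists (move u i 2 j 1); split; try lia.
have E : 2 * 2 ^ i = 2 ^ j %[mod mers h].
  rewrite -expnS /j; case: eqP => [->|//].
  by rewrite -mersS -addn1 modnDl.
apply/eqP; rewrite -(eqn_modDr (2 ^ j)); apply/eqP.
by rewrite -[in X in _ = X %% _](mul1n (2 ^ j)) -V -modnDmr -E modnDmr.
Qed.

(** Cyclic carries shorten a word and never erase it, so they end at digits 0
or 1. *)
Lemma cyclic_bits h u : 1 < h -> exists b,
  [/\ bits h b, bval h b = bval h u %[mod mers h], len h b <= len h u &
      0 < len h u -> 0 < len h b].
Proof.
move=> h1; elim/(@move_bits_ind h): u => [u B|u i ih ui IH]; first by exists u.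
have [w [Vw Lw w0]] := carry_cyclic h u i h1 ih ui.
have [|b [Bb Vb Lb b0]] := IH w; first lia.
by exists b; split=> //; [rewrite Vb | lia | move=> _; exact: b0].
Qed.

Lemma mers_gt0 h : 0 < h -> 0 < mers h.
Proof. by case: h => // h _; have := mersS h.+1; rewrite expnS; have := expn_gt0 2 h; lia. Qed.

(** Residues below 2^h - 1 have a unique word with digits 0 or 1, and any other
word of that residue reaches it by carries; only the residue 0 has two such
words, the empty one and the all-ones one. *)
Lemma bits_len_min h w u : 1 < h -> bits h w -> bval h w < mers h ->
  bval h w = bval h u %[mod mers h] -> len h w <= len h u.
Proof.
move=> h1 Bw Vw E; have [b [Bb Vb Lb b0]] := cyclic_bits h u h1.
have := bval_bits h b Bb; rewrite leq_eqVlt => /orP[/eqP Vm|Vlt].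
  have Vw0 : bval h w = 0.
    by rewrite -(modn_small Vw) E -Vb Vm modnn.
  have -> : len h w = 0; last by [].
  by rewrite /len big1 // => i _; apply: bval_eq0 Vw0 _ _.
have e : bval h w = bval h b by rewrite -(modn_small Vw) -(modn_small Vlt) E -Vb.
by rewrite (eq_len h w b) //; apply: bits_inj.
Qed.

Lemma bits_ones h b : bits h b -> bval h b = mers h -> forall i, i < h -> b i = 1.
Proof.
by move=> Bb Vb; apply: (bits_inj h b (fun=> 1)) => //; rewrite Vb bval_ones.
Qed.

(** A nonempty word of residue 0 carries down to the all-ones word. *)
Lemma len_zero_sum h u : 1 < h -> bval h u = 0 %[mod mers h] -> len h u < h ->
  len h u = 0.
Proof.
move=> h1 E lu; have [b [Bb Vb Lb b0]] := cyclic_bits h u h1.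
have m0 := mers_gt0 h (ltnW h1).
have := bval_bits h b Bb; rewrite leq_eqVlt => /orP[/eqP Vm|Vlt].
  have : len h b = h by rewrite (eq_len h b (fun=> 1)) ?len_ones //; apply: bits_ones.
  lia.
have Vb0 : bval h b = 0 by rewrite -(modn_small Vlt) Vb E mod0n.
have Lb0 : len h b = 0 by rewrite /len big1 // => i _; apply: bval_eq0 Vb0 _ _.
lia.
Qed.

Lemma len0_val h u : len h u = 0 -> forall i, i < h -> u i = 0.
Proof. by move=> L i ih; have := term_len h u i ih; lia. Qed.

Lemma bval_zero h u : (forall i, i < h -> u i = 0) -> bval h u = 0.
Proof. by move=> Z; rewrite /bval big1 // => i _; rewrite Z. Qed.

Lemma len_ge_mers h u : 1 < h -> 0 < bval h u -> bval h u = 0 %[mod mers h] -> h <= len h u.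
Proof.
move=> h1 V0 E; rewrite leqNgt; apply/negP => lu.
by have := bval_zero h u (len0_val h u (len_zero_sum h u h1 E lu)); lia.
Qed.

Lemma len_mers_ones h u : 1 < h -> bval h u = mers h -> len h u <= h ->
  forall i, i < h -> u i = 1.
Proof.
move=> h1 V lu; have [B|[i ih ui]] := bitsP h u; first exact: bits_ones.
have [w [Vw Lw w0]] := carry_cyclic h u i h1 ih ui.
have : len h w = 0 by apply: len_zero_sum => //; [rewrite Vw V modnn mod0n | lia].
lia.
Qed.

(** Carrying without wrapping around: the top digit absorbs the excess. *)
Lemma carry_top h u : exists w,
  [/\ bits h w, bval h.+1 w = bval h.+1 u & len h.+1 w <= len h.+1 u].
Proof.
have [n] := ubnP (len h.+1 u); elim: n u => // n IH u lu.
have [B|[i ih ui]] := bitsP h u; first by exists u.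
have ih1 : i < h.+1 by lia.
have V := bval_move h.+1 u i 2 i.+1 1 ih1 ih (ltac:(lia)) ui.
have L := len_move h.+1 u i 2 i.+1 1 ih1 ih (ltac:(lia)) ui.
have [|w [Bw Vw Lw]] := IH (move u i 2 i.+1 1); first lia.
exists w; split=> //; last lia.
by move: V; rewrite expnS; lia.
Qed.

Lemma bval_low_top h u : bits h u ->
  u h = bval h.+1 u %/ 2 ^ h /\ bval h u = bval h.+1 u %% 2 ^ h.
Proof.
move=> B; have lt : bval h u < 2 ^ h by rewrite -mersS ltnS bval_bits.
rewrite bvalS addnC divnMDl ?expn_gt0 // divn_small // addn0.
by rewrite modnMDl modn_small.
Qed.

(** Carrying leads to the top digit 5 and a lower part worth 2^(h-1) - 3;
adding the digit of value 2 to this part makes it a multiple of 2^(h-1) - 1,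
which bounds its length. *)
Lemma len_3mers h u : 2 < h -> bval h u = 3 * mers h -> h + 3 <= len h u.
Proof.
case: h => // h h2 V; have [w [Bw Vw Lw]] := carry_top h u.
suff : h.+1 + 3 <= len h.+1 w by lia.
have [wh low] := bval_low_top h w Bw.
have e4 : 4 <= 2 ^ h by apply: (@leq_pexp2l 2 2 h) => //; lia.
have VV : bval h.+1 w = 5 * 2 ^ h + (2 ^ h - 3).
  by rewrite Vw V; have := mersS h.+1; rewrite expnS; lia.
have w5 : w h = 5 by rewrite wh VV divnMDl ?divn_small; lia.
have V3 : bval h w = 2 ^ h - 3 by rewrite low VV modnMDl modn_small //; lia.
have i1 : 1 < h by lia.
have S := sum_update (fun n c => c * 2 ^ n) h w 1 (w 1).+1 i1.
have T := sum_update (fun n c => c) h w 1 (w 1).+1 i1.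
have : h <= len h (update w 1 (w 1).+1).
  have V1 : bval h (update w 1 (w 1).+1) = mers h.
    have := mersS h; move: S V3; rewrite /= -/(bval h w) -/(bval h (update w 1 (w 1).+1)); lia.
  apply: len_ge_mers => //; rewrite V1 ?modnn ?mod0n //; apply: mers_gt0; lia.
by move: T; rewrite /= -/(len h w) -/(len h (update w 1 (w 1).+1)) lenS w5; lia.
Qed.

(** * Reduced words: few digits against many *)

(** The bound 5 on the top digit is what the exchange of six tops for three
bottoms guarantees. *)
Definition reduced h (u : nat -> nat) := bits h u /\ u h <= 5.

Lemma reduced_bval h u : reduced h u -> bval h.+1 u <= 3 * mers h.+1 + 2.
Proof.
case=> B u5; rewrite bvalS; have := bval_bits h u B; have := mersS h; have := mersS h.+1.
rewrite expnS; have : u h * 2 ^ h <= 5 * 2 ^ h by rewrite leq_mul2r u5 orbT.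
lia.
Qed.

(** Wrapping pairs of tops around to the bottom makes the length at most two
more than the number of nonzero digits. *)
Lemma reduced_residue h u : 0 < h -> reduced h u -> exists w,
  [/\ bval h.+1 w = bval h.+1 u %[mod mers h.+1],
      len h.+1 w <= (supp h.+1 u).+2 & len h.+1 w = 0 -> len h.+1 u = 0].
Proof.
move=> h0 [B u5]; pose q := (u h)./2; exists (move u h (2 * q) 0 q).
have q2 : 2 * q <= u h by rewrite /q; lia.
have V := bval_move h.+1 u h (2 * q) 0 q (ltnSn h) (ltn0Sn h) (ltac:(lia)) q2.
have L := len_move h.+1 u h (2 * q) 0 q (ltnSn h) (ltn0Sn h) (ltac:(lia)) q2.
split.
- have E : 2 * q * 2 ^ h = q * mers h.+1 + q by have := mersS h.+1; rewrite expnS; nia.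
  apply/eqP; rewrite -(eqn_modDr (2 * q * 2 ^ h)) V E expn0 muln1 addnCA modnMDl.
  exact: eqxx.
- move: L; move: (len h.+1 (move _ _ _ _ _)) => l; rewrite lenS suppS (bits_supp h u B) /q.
  by case: (u h) u5 => [|[|[|[|[|[|]]]]]] //= _; lia.
- by move: L; rewrite !lenS /q; lia.
Qed.

(** Slightly above 2^h the binary digits start again from the bottom. *)
Lemma supp_few h u r J : bits h u -> bval h.+1 u = 2 ^ h.+1 + r -> r < 2 ^ J -> J <= h ->
  supp h.+1 u <= J.+1.
Proof.
move=> B V rJ Jh; have [_ low] := bval_low_top h u B.
have r2 : r < 2 ^ h by apply: leq_trans rJ _; rewrite leq_exp2l.
have {}low : bval h u = r by rewrite low V expnS modnMDl modn_small.
rewrite suppS; suff : supp h u <= J by lia.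
have Z i : J <= i -> i < h -> u i = 0.
  move=> Ji ih; have := term_bval h u i ih; rewrite low => Hr.
  have : 2 ^ J <= 2 ^ i by rewrite leq_exp2l.
  by case: (u i) Hr => // n; nia.
rewrite -(subnKC Jh) /supp big_split_ord /= [X in _ + X]big1 => [|i _].
  by rewrite addn0; exact: supp_le.
by rewrite Z //; have := ltn_ord i; lia.
Qed.

Lemma high_bit h u J : bits h u -> J <= h -> 2 ^ J <= bval h u ->
  exists i, [/\ J <= i, i < h & 0 < u i].
Proof.
elim: h => [|h IH] B.
  by rewrite leqn0 => /eqP ->; rewrite /bval big_ord0.
rewrite leq_eqVlt => /orP[/eqP ->|]; first by have := bval_bits h.+1 u B; have := mersS h.+1; lia.
rewrite ltnS => Jh V; case: (posnP (u h)) => [u0|u0]; last by exists h.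
have [|i [? ? ?]] := IH (bitsW h u B) Jh; first by move: V; rewrite bvalS u0; lia.
by exists i; split=> //; lia.
Qed.

Lemma supp_ge h u a b : b <= h -> (forall j, a <= j -> j < b -> 0 < u j) ->
  b - a <= supp h u.
Proof.
elim: h b => [|h IH] b; first by lia.
rewrite suppS leq_eqVlt ltnS => /orP[/eqP -> W|bh W]; last first.
  by apply: leq_trans (IH b bh W) _; rewrite leq_addr.
have := IH h (leqnn h) (fun j p q => W j p (ltnW q)).
by have [/W -> //|] := leqP a h; lia.
Qed.

(** The reverse of carrying: 2^i = 2^(i-1) + ... + 2^(i-q) + 2^(i-q), so q
splittings spread a digit over q positions. *)
Lemma split_digit h u i q : i < h -> 0 < u i -> q <= i -> exists w,
  [/\ bval h w = bval h u, len h w = len h u + q & q <= supp h w].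
Proof.
move=> ih ui qi.
(* The last digit must stay at least 2 after the first splitting, to be split again. *)
suff [w [V L W0 W]] : exists w, [/\ bval h w = bval h u, len h w = len h u + q,
    (0 < q) < w (i - q) & forall j, i - q <= j -> j < i -> 0 < w j].
  exists w; split=> //.
  by rewrite -{1}(subKn qi); apply: supp_ge => //; lia.
elim: q qi => [|q IH] qi.
  by exists u; rewrite addn0 subn0; split=> // j; lia.
have [|w [V L W0 W]] := IH; first lia.
have p1 : i - q < h by lia.
have p2 : i - q.+1 < h by lia.
have p3 : i - q != i - q.+1 by lia.
have p4 : 1 <= w (i - q) by lia.
have V' := bval_move h w (i - q) 1 (i - q.+1) 2 p1 p2 p3 p4.
have L' := len_move h w (i - q) 1 (i - q.+1) 2 p1 p2 p3 p4.
exists (move w (i - q) 1 (i - q.+1) 2); split.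
- by move: V'; rewrite (_ : i - q = (i - q.+1).+1) ?expnS; lia.
- lia.
- by rewrite /move /update eqxx; lia.
move=> j j1 j2; rewrite /move /update; case: eqP => [_|nj]; first lia.
case: eqP => [ej|nj2]; last by apply: W; lia.
by move: W0; rewrite (_ : 0 < q); lia.
Qed.

(** * Expansions over two blocks *)
Definition mult (h h' : nat) : nat := 3 * mers h * mers h'.
Definition weight (al be h h' : nat) (u v : nat -> nat) : nat :=
  al * mers h' * bval h u + be * mers h * bval h' v.

(** The parameters al, be stand for the factors 1, 2 in the weights of the two
blocks, and p, q for the costs of their elements; keeping them free makes the
two blocks interchangeable. *)
Definition expansion (al be p q h h' x z : nat) (u v : nat -> nat) : Prop :=
  x = mult h h' * (z + p * len h u + q * len h' v)
      + (mult h h').+1 * weight al be h h' u v.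
Definition tsupp (h h' z : nat) (u v : nat -> nat) : nat :=
  (0 < z) + supp h u + supp h' v.

Lemma multC h h' : mult h h' = mult h' h.
Proof. by rewrite /mult mulnAC. Qed.
Lemma expansion_swap {al be p q h h' x z u v} :
  expansion al be p q h h' x z u v -> expansion be al q p h' h x z v u.
Proof. by rewrite /expansion => ->; rewrite multC /weight; congr (_ * _ + _ * _); lia. Qed.
Lemma tsupp_swap h h' z u v : tsupp h h' z u v = tsupp h' h z v u.
Proof. by rewrite /tsupp; lia. Qed.

(** Lowering the weight by d times mult raises the cost by d times
mult + 1. *)
Lemma expansion_shift {al be p q h h' x z u v} d {z2 u2 v2} :
  expansion al be p q h h' x z u v ->
  weight al be h h' u v = weight al be h h' u2 v2 + d * mult h h' ->
  z2 + p * len h u2 + q * len h' v2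
    = z + p * len h u + q * len h' v + d * (mult h h').+1 ->
  expansion al be p q h h' x z2 u2 v2.
Proof. by rewrite /expansion => -> -> ->; ring. Qed.

Lemma expansion_mod {al be p q h h' x z u v} :
  expansion al be p q h h' x z u v -> x = weight al be h h' u v %[mod mult h h'].
Proof. by rewrite /expansion => ->; rewrite mulSn addnCA -mulnDr addnC [X in X + _]mulnC modnMDl. Qed.

Lemma bval_carry h u i : i < h -> 2 <= u i ->
  [/\ bval h.+1 (move u i 2 i.+1 1) = bval h.+1 u,
      (len h.+1 (move u i 2 i.+1 1)).+1 = len h.+1 u,
      supp h.+1 (move u i 2 i.+1 1) <= (supp h.+1 u).+1 &
      supp h.+1 u <= (supp h.+1 (move u i 2 i.+1 1)).+1].
Proof.
move=> ih ui; have ih1 : i < h.+1 by lia.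
have ij : i != i.+1 by lia.
have V := bval_move h.+1 u i 2 i.+1 1 ih1 ih ij ui.
have L := len_move h.+1 u i 2 i.+1 1 ih1 ih ij ui.
have [S1 S2] := supp_move h.+1 u i 2 i.+1 1 ih1 ih ij ui.
by split=> //; [move: V; rewrite expnS; lia | lia].
Qed.

Lemma bval_wrap h u n : 0 < h -> 2 * n <= u h ->
  let w := move u h (2 * n) 0 n in
  [/\ bval h.+1 w + n * mers h.+1 = bval h.+1 u,
      len h.+1 w + n = len h.+1 u,
      supp h.+1 w <= (supp h.+1 u).+1 &
      supp h.+1 u <= (supp h.+1 w).+1].
Proof.
move=> h0 uh w; have hh : h < h.+1 by []. have h00 : 0 < h.+1 by [].
have ij : h != 0 by lia.
have V := bval_move h.+1 u h (2 * n) 0 n hh h00 ij uh.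
have L := len_move h.+1 u h (2 * n) 0 n hh h00 ij uh.
have [S1 S2] := supp_move h.+1 u h (2 * n) 0 n hh h00 ij uh.
split=> //; rewrite -/w in V L; last by lia.
have E : 2 * n * 2 ^ h = n * mers h.+1 + n by have := mersS h.+1; rewrite expnS; nia.
by rewrite E in V; lia.
Qed.

(** Every exchange shortens the expansion and changes the number of generators
in use by at most 3, so a property P of this number that is stable under such
small changes can be carried along. *)
Lemma exists_reduced al be p q g g' x (P : nat -> Prop) : al + be = 3 -> 0 < g -> 0 < g' ->
  let F := expansion al be p q g.+1 g'.+1 x in
  let T := tsupp g.+1 g'.+1 in
  (forall z u v z2 u2 v2, F z u v -> F z2 u2 v2 ->
     T z u v <= T z2 u2 v2 + 3 -> T z2 u2 v2 <= T z u v + 3 ->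
     P (T z u v) -> P (T z2 u2 v2)) ->
  forall z u v, F z u v -> P (T z u v) ->
  exists z2 u2 v2, [/\ F z2 u2 v2, P (T z2 u2 v2), reduced g u2, reduced g' v2
    & u2 g <= 1 \/ v2 g' <= 1].
Proof.
move=> ab g0 g0' F T st z u v.
have [n] := ubnP (len g.+1 u + len g'.+1 v); elim: n z u v => // n IH z u v ln Fz Pz.
have recur z2 u2 v2 : len g.+1 u2 + len g'.+1 v2 < len g.+1 u + len g'.+1 v ->
    F z2 u2 v2 -> T z u v <= T z2 u2 v2 + 3 -> T z2 u2 v2 <= T z u v + 3 ->
  exists z2 u2 v2, [/\ F z2 u2 v2, P (T z2 u2 v2), reduced g u2, reduced g' v2
    & u2 g <= 1 \/ v2 g' <= 1].
  by move=> l F2 t1 t2; apply: (IH z2 u2 v2) => //; [lia | apply: st Pz].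
case: (bitsP g u) => [Bu|[i ih ui]]; last first.
  have [V L S1 S2] := bval_carry g u i ih ui.
  apply: (recur (z + p) (move u i 2 i.+1 1) v); rewrite /T /tsupp; try lia.
  by apply: (expansion_shift 0 Fz); rewrite /weight ?V -?L; lia.
case: (bitsP g' v) => [Bv|[i ih vi]]; last first.
  have [V L S1 S2] := bval_carry g' v i ih vi.
  apply: (recur (z + q) u (move v i 2 i.+1 1)); rewrite /T /tsupp; try lia.
  by apply: (expansion_shift 0 Fz); rewrite /weight ?V -?L; lia.
have [u5|u6] := leqP (u g) 5; last first.
  have [V L S1 S2] := bval_wrap g u 3 g0 u6.
  apply: (recur (z + 3 * p + al * (mult g.+1 g'.+1).+1) (move u g (2 * 3) 0 3) v);
    rewrite /T /tsupp; try lia.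
  by apply: (expansion_shift al Fz); rewrite /weight -?V -?L /mult; ring.
have [v5|v6] := leqP (v g') 5; last first.
  have [V L S1 S2] := bval_wrap g' v 3 g0' v6.
  apply: (recur (z + 3 * q + be * (mult g.+1 g'.+1).+1) u (move v g' (2 * 3) 0 3));
    rewrite /T /tsupp; try lia.
  by apply: (expansion_shift be Fz); rewrite /weight -?V -?L /mult; ring.
have [u1|u2] := leqP (u g) 1; first by exists z, u, v; split=> //; left.
have [v1|v2] := leqP (v g') 1; first by exists z, u, v; split=> //; right.
have [V L S1 S2] := bval_wrap g u 1 g0 u2.
have [V' L' S1' S2'] := bval_wrap g' v 1 g0' v2.
apply: (recur (z + p + q + (mult g.+1 g'.+1).+1) (move u g (2 * 1) 0 1) (move v g' (2 * 1) 0 1));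
  rewrite /T /tsupp; try lia.
have be3 : be = 3 - al by lia.
apply: (expansion_shift 1 Fz); rewrite /weight -?V -?L -?V' -?L' /mult; last by ring.
by rewrite -{1}ab; ring.
Qed.

Lemma coprime_mers2 h al : al < 3 -> 0 < al -> 0 < h -> coprime al (mers h).
Proof.
case: h => // h; case: al => [|[|[|]]] // _ _ _; rewrite ?coprime1n //.
by rewrite coprime2n; have := mersS h.+1; rewrite expnS => E; lia.
Qed.

(** The weights agree modulo mult, and al * mers h' is invertible modulo
mers h. *)
Lemma expansion_residue {al be p q g g' x z u v z2 u2 v2} : al + be = 3 -> 0 < al -> 0 < be ->
  coprime (mers g.+1) (mers g'.+1) ->
  expansion al be p q g.+1 g'.+1 x z u v -> expansion al be p q g.+1 g'.+1 x z2 u2 v2 ->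
  bval g.+1 u = bval g.+1 u2 %[mod mers g.+1].
Proof.
move=> ab a0 b0 co F F2.
have E := etrans (esym (expansion_mod F)) (expansion_mod F2).
have dv : mers g.+1 %| mult g.+1 g'.+1 by rewrite /mult mulnAC dvdn_mull.
have {}E : weight al be g.+1 g'.+1 u v = weight al be g.+1 g'.+1 u2 v2 %[mod mers g.+1].
  by rewrite -(modn_dvdm _ dv) E modn_dvdm.
have weightE y y' : weight al be g.+1 g'.+1 y y' =
    be * bval g'.+1 y' * mers g.+1 + al * mers g'.+1 * bval g.+1 y by rewrite /weight; ring.
move: E; rewrite !weightE !modnMDl.
have cp : coprime (mers g.+1) (al * mers g'.+1).
  by rewrite coprimeMr co andbT coprime_sym coprime_mers2 //; lia.
wlog le : u u2 {F F2} / bval g.+1 u <= bval g.+1 u2.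
  by move=> W E; case: (leqP (bval g.+1 u) (bval g.+1 u2)) => [/W|/ltnW /W H]; [apply | rewrite H].
move/esym/eqP; rewrite eqn_mod_dvd ?leq_mul2l ?le ?orbT // -mulnBr Gauss_dvdr //.
by move=> d; apply/esym/eqP; rewrite eqn_mod_dvd.
Qed.

Lemma bitsS h u : bits h u -> u h <= 1 -> bits h.+1 u.
Proof. by move=> B u1 i; rewrite ltnS leq_eqVlt => /orP[/eqP ->|/B]. Qed.

Lemma top_le1 h u : bval h.+1 u < 2 ^ h.+1 -> u h <= 1.
Proof.
rewrite bvalS expnS => lt; rewrite leqNgt; apply/negP => u2.
by have : 2 * 2 ^ h <= u h * 2 ^ h by [rewrite leq_mul2r u2 orbT]; lia.
Qed.

Lemma reduced_len h u : reduced h u -> len h.+1 u <= supp h.+1 u + 4.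
Proof. by case=> B u5; rewrite lenS suppS bits_supp //; lia. Qed.

(** * Large gaps force the all-ones words *)
Lemma bits_short h w u : 0 < h -> bits h.+1 w -> bval h.+1 w < mers h.+1 ->
  reduced h u -> bval h.+1 w = bval h.+1 u %[mod mers h.+1] ->
  supp h.+1 w <= (supp h.+1 u).+2.
Proof.
move=> h0 Bw Vw Ru E; have [u2 [E2 L2 _]] := reduced_residue h u h0 Ru.
rewrite bits_supp //; apply: leq_trans L2; apply: bits_len_min => //.
by rewrite E E2.
Qed.

(** The large expansion (w, w') and the small one (u, u') have congruent values
in each block.  In the first block w has digits 0 or 1, hence would be as short
as u unless it is the all-ones word; then u vanishes there.  In the second block
the value of w' may exceed mers by some r, and then r is the value of u'.
If r is small, w' has few nonzero digits; otherwise u' has a high digit, and the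
a0 freed by the all-ones words pays for splitting it, which yields an expansion
inside the gap. *)
Lemma reduced_large_full al be p q g g' x c c' zw w w' zu u u' :
  al + be = 3 -> 0 < al -> 0 < be ->
  0 < g -> 0 < g' -> coprime (mers g.+1) (mers g'.+1) ->
  c + g' + 4 < c' -> c + g + 4 < c' -> c + 2 < g.+1 -> c + 2 < g'.+1 ->
  q * (2 * c + 5) <= mult g.+1 g'.+1 ->
  (forall z v v', expansion al be p q g.+1 g'.+1 x z v v' ->
     ~~ (c < tsupp g.+1 g'.+1 z v v' < c')) ->
  expansion al be p q g.+1 g'.+1 x zw w w' -> c' <= tsupp g.+1 g'.+1 zw w w' ->
  bits g.+1 w -> reduced g' w' ->
  expansion al be p q g.+1 g'.+1 x zu u u' -> tsupp g.+1 g'.+1 zu u u' <= c ->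
  reduced g u -> reduced g' u' ->
  (forall i, i < g.+1 -> w i = 1) /\ (forall i, i < g'.+1 -> w' i = 1).
Proof.
move=> ab al0 be0 g0 g0' co c1 c2 c3 c4 bud gap Fw Tw Bw Rw' Fu Tu Ru Ru'.
have Ew := expansion_residue ab al0 be0 co Fw Fu.
have ba : be + al = 3 by lia.
have co' : coprime (mers g'.+1) (mers g.+1) by rewrite coprime_sym.
have Ew' := expansion_residue ba be0 al0 co'
  (expansion_swap Fw) (expansion_swap Fu).
have sw := supp_le g.+1 w; have sw' := supp_le g'.+1 w'.
have := bval_bits _ _ Bw; rewrite leq_eqVlt => /orP[/eqP Vw|Vw]; last first.
  by have := bits_short g w u g0 Bw Vw Ru Ew; move: Tw Tu sw' c1; rewrite /tsupp; clear; lia.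
have uz : len g.+1 u = 0.
  have [u2 [E2 L2 Z]] := reduced_residue g u g0 Ru; apply: Z.
  apply: len_zero_sum => //; first by rewrite E2 -Ew Vw modnn mod0n.
  by move: Tu L2 c3; rewrite /tsupp; clear; lia.
have Vu : bval g.+1 u = 0 by apply: bval_zero; apply: len0_val.
split; first exact: bits_ones.
have m2 := mersS g'.+1.
have [lt|gt|Vw'] := ltngtP (bval g'.+1 w') (mers g'.+1).
- have Bw' : bits g'.+1 w' by apply: bitsS; [case: Rw' | apply: top_le1; move: lt m2; clear; lia].
  by have := bits_short g' w' u' g0' Bw' lt Ru' Ew'; move: Tw Tu sw c2; rewrite /tsupp; clear; lia.
- have rw := reduced_bval g' w' Rw'; have ru := reduced_bval g' u' Ru'.
  have [r r0 Vr] : exists2 r, 0 < r & bval g'.+1 w' = mers g'.+1 + r.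
    by exists (bval g'.+1 w' - mers g'.+1); move: gt; clear; lia.
  have Vr2 : bval g'.+1 w' = 2 ^ g'.+1 + r.-1 by move: Vr r0 m2; clear; lia.
  (* Otherwise w' consists of the top digit and at most c + 1 low ones. *)
  have few : 2 ^ c.+1 <= r.-1.
    rewrite leqNgt; apply/negP => lt.
    have J : c.+1 <= g' by move: c4; clear; lia.
    have := supp_few g' w' r.-1 c.+1 (proj1 Rw') Vr2 lt J.
    by move: Tw sw c2; rewrite /tsupp; clear; lia.
  have two : 2 <= 2 ^ c.+1 by rewrite expnS leq_pmulr ?expn_gt0.
  have m3 : 2 < mers g'.+1.
    have : 2 ^ 2 <= 2 ^ g'.+1 by rewrite leq_exp2l // ltnS.
    by move: m2; clear; lia.
  have mg : 0 < mers g.+1 by apply: mers_gt0.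
  have Er : r = bval g'.+1 u'.
    have := etrans (esym (expansion_mod Fw)) (expansion_mod Fu).
    rewrite /weight Vw Vu Vr muln0 add0n.
    have -> : al * mers g'.+1 * mers g.+1 + be * mers g.+1 * (mers g'.+1 + r)
       = 1 * mult g.+1 g'.+1 + mers g.+1 * (be * r) by rewrite /mult -ab; ring.
    have -> : be * mers g.+1 * bval g'.+1 u' = mers g.+1 * (be * bval g'.+1 u') by ring.
    have -> : mult g.+1 g'.+1 = mers g.+1 * (3 * mers g'.+1) by rewrite /mult; ring.
    rewrite modnMDl -!muln_modr => /eqP; rewrite eqn_mul2l eqn0Ngt mg /= => /eqP E.
    have cb : coprime (3 * mers g'.+1) be.
      rewrite coprimeMl ![coprime _ be]coprime_sym [coprime _ (mers _)]coprime_mers2 //;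
        last by move: ab al0; clear; lia.
      by rewrite andbT; move: be0 ab al0; clear; case: be => [|[|[|]]] //; lia.
    have r3 : r < 3 * mers g'.+1 by move: rw Vr m3; clear; lia.
    have {}E : r = bval g'.+1 u' %[mod 3 * mers g'.+1].
      have [le|/ltnW le] := leqP r (bval g'.+1 u').
        move/esym/eqP: E; rewrite eqn_mod_dvd ?leq_mul2l ?le ?orbT // -mulnBr Gauss_dvdr //.
        by move=> d; apply/esym/eqP; rewrite eqn_mod_dvd.
      move/eqP: E; rewrite eqn_mod_dvd ?leq_mul2l ?le ?orbT // -mulnBr Gauss_dvdr //.
      by move=> d; apply/eqP; rewrite eqn_mod_dvd.
    have [lt|ge] := ltnP (bval g'.+1 u') (3 * mers g'.+1).
      by rewrite -(modn_small r3) E modn_small.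
    have e : bval g'.+1 u' = 3 * mers g'.+1 + (bval g'.+1 u' - 3 * mers g'.+1) by move: ge; clear; lia.
    move: E; rewrite {1}e modnDl (modn_small r3) modn_small; move: ru m3 few two e; clear; lia.
  have [i [ci ig ui]] : exists i, [/\ c.+1 <= i, i < g'.+1 & 0 < u' i].
    have [B' _] := Ru'.
    case: (posnP (u' g')) => [z0|]; last by exists g'; split=> //; move: c4; clear; lia.
    have B2 : bits g'.+1 u' by apply: bitsS => //; rewrite z0.
    have J : c.+1 <= g'.+1 by move: c4; clear; lia.
    by apply: high_bit => //; move: few Er; clear; lia.
  have [v [Vv Lv Sv]] := split_digit g'.+1 u' i c.+1 ig ui ci.
  have su := reduced_len g' u' Ru'.
  (* The weights of w and u differ by exactly mult, so u has mult + 1 extra units of cost. *)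
  have budget : q * (len g'.+1 u' + c.+1) <= zu + q * len g'.+1 u'.
    have le1 : q * (len g'.+1 u' + c.+1) <= q * (2 * c + 5).
      by rewrite leq_mul2l; apply/orP; right; move: Tu su; rewrite /tsupp; clear; lia.
    have pE : weight al be g.+1 g'.+1 w w' = weight al be g.+1 g'.+1 u u' + mult g.+1 g'.+1.
      by rewrite /weight Vw Vu Vr Er /mult -ab; ring.
    have : zu + q * len g'.+1 u' = zw + p * len g.+1 w + q * len g'.+1 w' + (mult g.+1 g'.+1).+1.
      have m0 : 0 < mult g.+1 g'.+1 by rewrite /mult !muln_gt0 mg /=; lia.
      move: Fu; rewrite Fw /expansion pE uz muln0 addn0 => H.
      apply/eqP; rewrite -(eqn_pmul2l m0); apply/eqP.
      move: H; clear; move: (mult _ _) (weight _ _ _ _ _ _) => A E; rewrite !(mulnDr A) mulSn; nia.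
    by move: le1 bud; clear; lia.
  have Fv : expansion al be p q g.+1 g'.+1 x (zu - q * c.+1) u v.
    apply: (expansion_shift 0 Fu); first by rewrite /weight Vv addn0.
    by rewrite Lv; move: budget; clear; lia.
  have := gap _ _ _ Fv; have := supp_le g'.+1 v.
  have : supp g.+1 u = 0 by have := supp_len g.+1 u; move: uz; clear; lia.
  by move: Sv c1; rewrite /tsupp; clear; lia.
- apply: bits_ones => //; apply: bitsS; first by case: Rw'.
  by apply: top_le1; rewrite Vw' -m2.
Qed.

(** The reduced large expansion has a top digit at most 1 in one of the blocks;
the two cases are exchanged by swapping the blocks. *)
Lemma gap_only_at_zero al be p q g g' x c c' :
  al + be = 3 -> 0 < al -> 0 < be ->
  0 < g -> 0 < g' -> coprime (mers g.+1) (mers g'.+1) ->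
  c + g' + 4 < c' -> c + g + 4 < c' -> c + 2 < g.+1 -> c + 2 < g'.+1 ->
  p * (2 * c + 5) <= mult g.+1 g'.+1 ->
  q * (2 * c + 5) <= mult g.+1 g'.+1 ->
  (forall z v v', expansion al be p q g.+1 g'.+1 x z v v' ->
     ~~ (c < tsupp g.+1 g'.+1 z v v' < c')) ->
  forall zw w w' zu u u',
  expansion al be p q g.+1 g'.+1 x zw w w' -> c' <= tsupp g.+1 g'.+1 zw w w' ->
  expansion al be p q g.+1 g'.+1 x zu u u' -> tsupp g.+1 g'.+1 zu u u' <= c ->
  exists z, expansion al be p q g.+1 g'.+1 x z (fun=> 1) (fun=> 1).
Proof.
move=> ab al0 be0 g0 g0' co c1 c2 c3 c4 budp budq gap zw w w' zu u u' Fw Tw Fu Tu.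
have [|zw2 [w2 [w2' [{}Fw {}Tw Rw Rw' tops]]]] :=
  exists_reduced al be p q g g' x (fun n => c' <= n) ab g0 g0' _ zw w w' Fw Tw.
  by move=> z v v' z2 v2 v2' _ /gap; lia.
have [|zu2 [u2 [u2' [{}Fu {}Tu Ru Ru' _]]]] :=
  exists_reduced al be p q g g' x (fun n => n <= c) ab g0 g0' _ zu u u' Fu Tu.
  by move=> z v v' z2 v2 v2' _ /gap; lia.
suff [o o'] : (forall i, i < g.+1 -> w2 i = 1) /\ (forall i, i < g'.+1 -> w2' i = 1).
  exists zw2; apply: (expansion_shift 0 Fw).
    by rewrite /weight (eq_bval _ _ _ o) (eq_bval _ _ _ o') addn0.
  by rewrite (eq_len _ _ _ o) (eq_len _ _ _ o') addn0.
case: tops => top.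
  apply: (reduced_large_full al be p q g g' x c c' zw2 w2 w2' zu2 u2 u2') => //.
  by apply: bitsS => //; case: Rw.
have co' : coprime (mers g'.+1) (mers g.+1) by rewrite coprime_sym.
suff [] : (forall i, i < g'.+1 -> w2' i = 1) /\ (forall i, i < g.+1 -> w2 i = 1) by [].
apply: (reduced_large_full be al q p g' g x c c' zw2 w2' w2 zu2 u2' u2) => //; try lia.
- by rewrite multC.
- by move=> z v v' F; rewrite tsupp_swap; apply: gap; apply: expansion_swap.
- exact: expansion_swap.
- by rewrite tsupp_swap.
- by apply: bitsS => //; case: Rw'.
- exact: expansion_swap.
- by rewrite tsupp_swap.
Qed.

(** * Choice of the two blocks *)

(** From a h = b h' + 1 one gets 2^(a h) - 1 = 2 (2^(b h') - 1) + 1. *)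
Lemma coprime_mers h h' : coprime h h' -> 0 < h -> 0 < h' ->
  coprime (mers h) (mers h').
Proof.
move=> co h0 h0'; have [[a b] /= ab] := coprimeP _ h0 co.
rewrite /coprime -dvdn1; set d := gcdn _ _.
have d1 : d %| mers (a * h).
  apply: dvdn_trans (dvdn_gcdl _ _) _; rewrite /mers mulnC expnM; exact: dvdn_pred_predX.
have d2 : d %| mers (b * h').
  apply: dvdn_trans (dvdn_gcdr _ _) _; rewrite /mers mulnC expnM; exact: dvdn_pred_predX.
have E : mers (a * h) = mers (b * h') * 2 + 1.
  have := mersS (a * h); have := mersS (b * h').
  by rewrite (_ : a * h = (b * h').+1) ?expnS; [lia | clear d d1 d2; lia].
by rewrite -(dvdn_addr 1 (dvdn_mulr 2 d2)) -E.
Qed.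

(** The halves differ by 1, 2 or 4 and are odd when the difference is even. *)
Lemma coprime_halves k : 16 <= k -> exists h h',
  [/\ k = h + h', coprime h h', k <= 2 * h + 4 & k <= 2 * h' + 4].
Proof.
move=> k16; have co n e : odd n -> coprime n (n + 2 ^ e).
  by move=> on; rewrite /coprime gcdnDl -/(coprime _ _) coprimeXr // coprimen2.
case ok : (odd k).
  exists k./2, k./2.+1; split; try lia; exact: coprimenS.
case ok2 : (odd k./2).
  exists (k./2 - 2), (k./2 + 2); split; try lia.
  by rewrite (_ : _ + 2 = k./2 - 2 + 2 ^ 2); [apply: co; lia | lia].
exists (k./2 - 1), (k./2 + 1); split; try lia.
by rewrite (_ : _ + 1 = k./2 - 1 + 2 ^ 1); [apply: co; lia | lia].
Qed.

Lemma mers_ge h : 1 < h -> h < mers h.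
Proof.
elim: h => // -[|h] IH // _; have := mersS h.+1; have := mersS h.+2; rewrite expnS.
by case: h IH => [|h] IH; [lia | have := IH isT; lia].
Qed.

Lemma odd_mers h : 0 < h -> odd (mers h).
Proof. by case: h => // h _; have := mersS h.+1; rewrite expnS; lia. Qed.

Definition unit_vec (i : nat) : nat -> nat := fun j => j == i.

Lemma bval_unit h i : i < h -> bval h (unit_vec i) = 2 ^ i.
Proof.
move=> ih; rewrite /bval (bigD1 (Ordinal ih)) //= /unit_vec eqxx mul1n big1 ?addn0 // => j.
by rewrite -val_eqE /= => /negPf ->.
Qed.

Lemma bval_gt0_len h u : 0 < bval h u -> 0 < len h u.
Proof.
rewrite !lt0n; apply: contra => /eqP L; apply/eqP.
by apply: bval_zero; apply: len0_val.
Qed.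

(** With weight below mult and cost at most mult there is no room to trade
weight for cost in either direction. *)
Lemma expansion_small {al be p q h h' y E z u v} : E < mult h h' -> y <= mult h h' ->
  expansion al be p q h h' (mult h h' * y + (mult h h').+1 * E) z u v ->
  weight al be h h' u v = E /\ y = z + p * len h u + q * len h' v.
Proof.
move=> Elt yle F; have a0 : 0 < mult h h' by apply: leq_ltn_trans Elt.
have E1 : E = weight al be h h' u v %[mod mult h h'].
  by rewrite -(expansion_mod F) mulSn addnCA -mulnDr addnC mulnC modnMDl.
have := divn_eq (weight al be h h' u v) (mult h h').
rewrite -E1 (modn_small Elt); move: (_ %/ _) => j Ej.
move: F; rewrite /expansion Ej; move: (z + _ + _) => Y F.
have {F} : mult h h' * y = mult h h' * (Y + j * (mult h h').+1) by clear -F; lia.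
move/eqP; rewrite eqn_mul2l eqn0Ngt a0 /= => /eqP yE.
have j0 : j = 0 by move: yle yE; clear; case: j => // j; nia.
by split; [rewrite j0 | rewrite yE j0 addn0].
Qed.

(** The weight fixes the values of the two words, and the cost p allows one
element of the first block only. *)
Lemma generator_needed al be p q g g' i z u v : al + be = 3 -> 0 < al -> 0 < be ->
  0 < g -> 0 < g' -> coprime (mers g.+1) (mers g'.+1) -> 0 < p ->
  p <= mult g.+1 g'.+1 -> i < g.+1 ->
  expansion al be p q g.+1 g'.+1 (mult g.+1 g'.+1 * p +
    (mult g.+1 g'.+1).+1 * (al * mers g'.+1 * 2 ^ i)) z u v ->
  0 < u i.
Proof.
move=> ab al0 be0 g0 g0' co p0 pm ig F.
have M0 : 0 < mers g.+1 by apply: mers_gt0.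
have M0' : 0 < mers g'.+1 by apply: mers_gt0.
have ilt : 2 ^ i < mers g.+1.
  have := mersS g.+1; rewrite expnS.
  have : 2 ^ i <= 2 ^ g by rewrite leq_exp2l.
  have : 2 ^ 1 <= 2 ^ g by rewrite leq_exp2l.
  by clear; lia.
have Elt : al * mers g'.+1 * 2 ^ i < mult g.+1 g'.+1.
  rewrite /mult -mulnA [mers g'.+1 * _]mulnC mulnA ltn_pmul2r //.
  apply: ltn_mull; rewrite ?(ltnW ilt) //.
  by move: ab be0; clear; lia.
have [pE pY] := expansion_small Elt pm F.
have F0 : expansion al be p q g.+1 g'.+1 (mult g.+1 g'.+1 * p +
    (mult g.+1 g'.+1).+1 * (al * mers g'.+1 * 2 ^ i)) 0 (unit_vec i) (fun=> 0).
  rewrite /expansion /weight bval_unit // (bval_zero g'.+1) // muln0 addn0.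
  have -> : len g'.+1 (fun=> 0) = 0 by rewrite /len big1.
  suff -> : len g.+1 (unit_vec i) = 1 by rewrite muln0 addn0 add0n muln1.
  rewrite /len (bigD1 (Ordinal ig)) //= /unit_vec eqxx big1 ?addn0 // => j.
  by rewrite -val_eqE /= => /negPf ->.
have := expansion_residue ab al0 be0 co F F0.
have Vle : bval g.+1 u <= 2 ^ i.
  have : al * mers g'.+1 * bval g.+1 u <= al * mers g'.+1 * 2 ^ i by rewrite -pE /weight leq_addr.
  by rewrite leq_pmul2l // muln_gt0 al0.
rewrite bval_unit // (modn_small ilt) modn_small ?(leq_ltn_trans Vle) // => V.
have lp : 0 < len g.+1 u by apply: bval_gt0_len; rewrite V expn_gt0.
have l1 : len g.+1 u <= 1.
  by rewrite -(leq_pmul2l p0) muln1; move: pY; clear; lia.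
have Bu : bits g.+1 u by move=> j jg; apply: leq_trans (term_len _ _ _ jg) l1.
rewrite (bits_inj g.+1 u (unit_vec i)) ?bval_unit //; first by rewrite /unit_vec eqxx.
by move=> j _; rewrite /unit_vec; case: eqP.
Qed.

Section Concrete.
Variables g g' : nat.
Let h := g.+1.
Let h' := g'.+1.
Let a0 := mult h h'.
Hypotheses (h2 : 2 < h) (h2' : 2 < h') (co : coprime (mers h) (mers h')).

(** The cost of one copy of each element of the two blocks. *)
Definition full_cost (g g' : nat) : nat := g'.+2 * g.+1 + 3 * g'.+1.

Lemma full_cost_lt : full_cost g g' + 2 < a0.
Proof.
rewrite /full_cost /a0 /mult -/h -/h' -[g'.+2]/h'.+1.
have M : h < mers h by apply: mers_ge; move: h2; clear; lia.
have M' : h' < mers h' by apply: mers_ge; move: h2'; clear; lia.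
have : h.+1 * h'.+1 <= mers h * mers h' by apply: leq_mul.
by rewrite -mulnA; clear; lia.
Qed.

(** The weight is j * mult with j <= 1, and for j = 1 the values are s * mers h
and t * mers h' with s + 2 t = 3.  The pair (1, 1) costs at least full_cost, with
equality only for the all-ones words, and each further element adds at least 3;
the pair (3, 0) costs at least (h' + 1) (h + 3) = full_cost + 3 by len_3mers. *)
Lemma zero_class y z u v : y <= full_cost g g' + a0.+1 + 2 ->
  expansion 1 2 h'.+1 3 h h' (a0 * y) z u v ->
  [/\ len h u = 0, len h' v = 0 & z = y] \/
  [/\ forall i, i < h -> u i = 1, forall i, i < h' -> v i = 1
    & z + full_cost g g' + a0.+1 = y].
Proof.
move=> yle F; have fl := full_cost_lt.
have h1 : 1 < h by move: h2; clear; lia.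
have h1' : 1 < h' by move: h2'; clear; lia.
have M0 : 0 < mers h by apply: mers_gt0.
have M0' : 0 < mers h' by apply: mers_gt0.
have a00 : 0 < a0 by rewrite /a0 /mult !muln_gt0 M0.
have [j Ej] : exists j, weight 1 2 h h' u v = j * a0.
  apply/dvdnP; have := expansion_mod F.
  by rewrite -/a0 /dvdn modnMr => <-.
have {F} yE : y = z + h'.+1 * len h u + 3 * len h' v + j * a0.+1.
  apply/eqP; rewrite -(eqn_pmul2l a00) F /expansion Ej -/a0; apply/eqP; ring.
have : j < 2.
  rewrite ltnNge; apply/negP => j2; have : 2 * a0.+1 <= j * a0.+1 by rewrite leq_mul2r j2 orbT.
  by move: yle fl yE; clear; lia.
case: j Ej yE => [|[|//]] Ej yE _.
  left; move/eqP: Ej; rewrite mul0n /weight addn_eq0 !muln_eq0 /= !eqn0Ngt M0 M0' /= -!eqn0Ngt.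
  case/andP => /eqP u0 /eqP v0.
  have lu : len h u = 0.
    by rewrite /len big1 // => i _; apply: bval_eq0 u0 _ _.
  have lv : len h' v = 0.
    by rewrite /len big1 // => i _; apply: bval_eq0 v0 _ _.
  by split=> //; move: yE; rewrite lu lv; clear; lia.
right; rewrite mul1n in Ej yE.
have [s Vs] : exists s, bval h u = s * mers h.
  apply/dvdnP; rewrite -(Gauss_dvdr _ co) -(dvdn_addl (n := 2 * mers h * bval h' v)); last first.
    by rewrite mulnAC dvdn_mull.
  have -> : mers h' * bval h u + 2 * mers h * bval h' v = a0.
    by rewrite -Ej /weight mul1n.
  by rewrite /a0 /mult mulnAC dvdn_mull.
have [t Vt] : exists t, bval h' v = t * mers h'.
  apply/dvdnP.
  have co2 : coprime (mers h') (2 * mers h).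
    by rewrite coprimeMr [coprime _ (mers h)]coprime_sym co andbT coprimen2 odd_mers.
  rewrite -(Gauss_dvdr _ co2) -(dvdn_addr (m := 1 * mers h' * bval h u)); last first.
    by rewrite mulnAC dvdn_mull.
  have -> : 1 * mers h' * bval h u + 2 * mers h * bval h' v = a0 by rewrite -Ej.
  by rewrite /a0 /mult dvdn_mull.
have st : s + 2 * t = 3.
  have : (s + 2 * t) * (mers h * mers h') = 3 * (mers h * mers h').
    by rewrite [RHS]mulnA -[RHS]Ej /weight Vs Vt; ring.
  by move/eqP; rewrite eqn_mul2r muln_eq0 !eqn0Ngt M0 M0' /= => /eqP.
have lenv : h'.+1 * len h u + 3 * len h' v <= full_cost g g' + 2.
  by move: yle yE; clear; lia.
case: t st Vt => [|[|t]] st Vt; last by move: st; clear; lia.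
  have s3 : s = 3 by move: st; clear; lia.
  have := len_3mers h u h2; rewrite Vs s3 => /(_ erefl) l3.
  have : h'.+1 * (h + 3) <= h'.+1 * len h u by rewrite leq_mul2l l3 orbT.
  by move: lenv; rewrite /full_cost -/h -/h' -[g'.+2]/h'.+1; clear; lia.
have s1 : s = 1 by move: st; clear; lia.
rewrite s1 mul1n in Vs; rewrite mul1n in Vt.
have lu : h <= len h u by apply: len_ge_mers => //; rewrite Vs ?modnn ?mod0n.
have lv : h' <= len h' v by apply: len_ge_mers => //; rewrite Vt ?modnn ?mod0n.
have : h'.+1 * h <= h'.+1 * len h u by rewrite leq_mul2l lu orbT.
move: lenv; rewrite /full_cost -/h -/h' -[g'.+2]/h'.+1 => lenv lenu.
have lve : len h' v <= h' by move: lenv lenu; clear; lia.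
have lue : len h u <= h.
  rewrite leqNgt; apply/negP => lt.
  have : h'.+1 * h.+1 <= h'.+1 * len h u by rewrite leq_mul2l lt orbT.
  by move: lenv lv h2'; rewrite mulnS; clear; lia.
split; [exact: len_mers_ones | exact: len_mers_ones | ].
have lue' : len h u = h by apply/eqP; rewrite eqn_leq lue.
have lve' : len h' v = h' by apply/eqP; rewrite eqn_leq lve.
by rewrite yE lue' lve' /full_cost -/h -/h' -[g'.+2]/h'.+1; clear; lia.
Qed.

(** The shortest word of value 3 (2^h - 1). *)
Definition three_mers (g : nat) : nat -> nat :=
  fun i => if i == 1 then 0 else if i == g then 5 else 1.

Lemma three_mersE : [/\ bval h (three_mers g) = 3 * mers h,
  len h (three_mers g) = h + 3 & supp h (three_mers g) = g].
Proof.
have g1 : 1 < g by move: h2; rewrite /h; clear; lia.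
pose w := update (fun=> 1) 1 0.
have E i : i < g -> three_mers g i = w i.
  by move=> ig; rewrite /three_mers /w /update (ltn_eqF ig).
have top : three_mers g g = 5 by rewrite /three_mers eqxx; case: eqP => // e; move: g1; rewrite e.
have V := sum_update (fun n c => c * 2 ^ n) g (fun=> 1) 1 0 g1.
have L := sum_update (fun n c => c) g (fun=> 1) 1 0 g1.
have Bw : bits g w by move=> i _; rewrite /w /update; case: eqP.
rewrite /= -/(bval g (fun=> 1)) -/w -/(bval g w) bval_ones in V.
rewrite /= -/(len g (fun=> 1)) -/w -/(len g w) len_ones in L.
rewrite /h bvalS lenS suppS top (eq_bval _ _ _ E) (eq_len _ _ _ E).
have -> : supp g (three_mers g) = supp g w by apply: eq_bigr => i _; rewrite E.
rewrite (bits_supp _ _ Bw).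
have := mersS g; have := mersS g.+1; rewrite expnS => K K'.
by split; move: V L g1 K K'; clear; lia.
Qed.

End Concrete.

Local Open Scope classical_set_scope.

(** * The semigroup and its factorizations *)
Definition gen (g g' n : nat) : nat :=
  let h := g.+1 in let h' := g'.+1 in let a0 := mult h h' in
  if n is i.+1 then
    if i < h then a0 * h'.+1 + a0.+1 * (1 * mers h' * 2 ^ i)
    else a0 * 3 + a0.+1 * (2 * mers h * 2 ^ (i - h))
  else a0.

Definition gens (g g' : nat) (i : 'I_(g.+1 + g'.+1).+1) : nat := gen g g' i.

(** The cost h' + 1 is chosen so that a word of value 3 (2^h - 1) is three units
dearer than the all-ones words, the same as a single splitting in the second
block: no other zero-sum word comes earlier. *)
Definition sexpansion g g' x z u v := expansion 1 2 g'.+2 3 g.+1 g'.+1 x z u v.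

Lemma sum_blocks g g' (F : nat -> nat) :
  \sum_(i < (g.+1 + g'.+1).+1) F i =
  F 0 + \sum_(i < g.+1) F i.+1 + \sum_(j < g'.+1) F (g.+1 + j).+1.
Proof. by rewrite big_ord_recl big_split_ord /= addnA. Qed.

Lemma gen_sum g g' (f : nat -> nat) :
  \sum_(i < (g.+1 + g'.+1).+1) f i * gen g g' i =
  mult g.+1 g'.+1 * (f 0 + g'.+2 * len g.+1 (fun i => f i.+1)
                         + 3 * len g'.+1 (fun j => f (g.+1 + j).+1))
  + (mult g.+1 g'.+1).+1 *
    weight 1 2 g.+1 g'.+1 (fun i => f i.+1) (fun j => f (g.+1 + j).+1).
Proof.
rewrite (sum_blocks g g' (fun i => f i * gen g g' i)) /=.
rewrite (eq_bigr (fun i : 'I_g.+1 => mult g.+1 g'.+1 * g'.+2 * f i.+1 +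
  (mult g.+1 g'.+1).+1 * (1 * mers g'.+1) * (f i.+1 * 2 ^ i))); last first.
  by move=> i _; rewrite ltn_ord; ring.
rewrite [X in _ + X](eq_bigr (fun j : 'I_g'.+1 => mult g.+1 g'.+1 * 3 * f (g.+1 + j).+1 +
  (mult g.+1 g'.+1).+1 * (2 * mers g.+1) * (f (g.+1 + j).+1 * 2 ^ j))); last first.
  by move=> j _; rewrite ltnNge leq_addr /= addKn; ring.
by rewrite !big_split /= -!big_distrr /= /weight /len /bval; ring.
Qed.

Lemma factorizationsP {g g' x} {z : 'I_(g.+1 + g'.+1).+1 -> nat} :
  factorizations (gens g g') x z ->
  exists z0 u v, sexpansion g g' x z0 u v /\ ell0 z = tsupp g.+1 g'.+1 z0 u v.
Proof.
pose f n := z (inord n).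
have zf i : z i = f i by rewrite /f inord_val.
move=> Fz; exists (f 0), (fun i => f i.+1), (fun j => f (g.+1 + j).+1); split.
  rewrite /sexpansion /expansion -gen_sum Fz; apply: eq_bigr => i _; by rewrite zf.
rewrite /ell0 -sum1_card big_mkcond /= /tsupp /supp.
rewrite -(sum_blocks g g' (fun n => nat_of_bool (0 < f n))).
by apply: eq_bigr => i _; rewrite inE zf; case: (0 < _).
Qed.

Definition glue g (z0 : nat) (u v : nat -> nat) : nat -> nat :=
  fun n => if n is i.+1 then if i < g.+1 then u i else v (i - g.+1) else z0.

Lemma factorizations_glue {g g' x z0 u v} : sexpansion g g' x z0 u v ->
  exists z : 'I_(g.+1 + g'.+1).+1 -> nat,
    factorizations (gens g g') x z /\ ell0 z = tsupp g.+1 g'.+1 z0 u v.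
Proof.
move=> F; pose f := glue g z0 u v; exists (fun i => f i).
have fu i : i < g.+1 -> f i.+1 = u i by rewrite /f /= => ->.
have fv j : j < g'.+1 -> f (g.+1 + j).+1 = v j.
  by move=> _; rewrite /f /glue ltnNge leq_addr addKn.
split.
  rewrite /factorizations /= (gen_sum g g' f) /= /weight.
  by rewrite (eq_bval _ _ _ fu) (eq_len _ _ _ fu) (eq_bval _ _ _ fv) (eq_len _ _ _ fv).
rewrite /ell0 -sum1_card big_mkcond /= /tsupp.
have -> : supp g.+1 u = supp g.+1 (fun i => f i.+1) by apply: eq_bigr => i _; rewrite fu.
have -> : supp g'.+1 v = supp g'.+1 (fun i => f (g.+1 + i).+1) by apply: eq_bigr => i _; rewrite fv.
rewrite -[z0]/(f 0) /supp -(sum_blocks g g' (fun n => nat_of_bool (0 < f n))).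
by apply: eq_bigr => i _; rewrite inE; case: (0 < _).
Qed.

Lemma L0P g g' x c : L0 (gens g g') x c <->
  exists z u v, sexpansion g g' x z u v /\ c = tsupp g.+1 g'.+1 z u v.
Proof.
split=> [[z Fz <-]|[z [u [v [F ->]]]]].
  by have [z0 [u [v [F E]]]] := factorizationsP Fz; exists z0, u, v.
by have [w [Fw E]] := factorizations_glue F; exists w.
Qed.

Definition semi g g' : set nat := generated (gens g g') [set: 'I_(g.+1 + g'.+1).+1]%SET.

Lemma generatedT n (a : 'I_n -> nat) x :
  generated a [set: 'I_n]%SET x <-> exists z, factorizations a x z.
Proof.
have sE z : \sum_(i in [set: 'I_n]%SET) z i * a i = \sum_(i < n) z i * a i.
  by apply: eq_bigl => i; rewrite inE.
by split=> -[z Ez]; exists z; move: Ez; rewrite /factorizations /= sE.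
Qed.

Lemma semiP g g' x : semi g g' x <-> exists z u v, sexpansion g g' x z u v.
Proof.
rewrite /semi generatedT; split=> [[z /factorizationsP [z0 [u [v [F _]]]]]|[z [u [v F]]]].
  by exists z0, u, v.
by have [w [Fw _]] := factorizations_glue F; exists w.
Qed.

Definition first_vec (n : nat) : nat -> nat := fun i => if i == 0 then n else 0.

Lemma bval_first h n : bval h.+1 (first_vec n) = n.
Proof. by rewrite /bval big_ord_recl big1 /= ?addn0 ?muln1. Qed.
Lemma len_first h n : len h.+1 (first_vec n) = n.
Proof. by rewrite /len big_ord_recl big1 /= ?addn0. Qed.

(** Bezout: the two blocks together reach every residue modulo mult. *)
Lemma weight_surj h h' r : 0 < mers h' -> 0 < mers h -> coprime (mers h') (2 * mers h) ->
  exists V V' T, mers h' * V + 2 * mers h * V' = r + T * mult h h'.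
Proof.
move=> M0' M0 co; have [[a b] /= ab] := coprimeP _ M0' co.
have E : a * mers h' = 2 * mers h * b + 1 by move: ab; rewrite [2 * _ * b]mulnC; clear; lia.
have m0 : 0 < mult h h' by rewrite /mult !muln_gt0 M0.
exists (r * a), (r * b * (mult h h').-1), (2 * mers h * r * b).
have -> : mers h' * (r * a) = r * (a * mers h') by ring.
rewrite E.
by case: (mult h h') m0 => // n _ /=; ring.
Qed.

(** Every residue modulo the generator mult is reached, and adding copies of
mult stays inside the semigroup. *)
Lemma semi_numerical g g' : 1 < g -> 1 < g' -> coprime (mers g.+1) (mers g'.+1) ->
  numerical_semigroup (semi g g').
Proof.
move=> g1 g1' co; split.
- apply/semiP; exists 0, (fun=> 0), (fun=> 0).
  by rewrite /sexpansion /expansion /weight /len /bval !big1 // !muln0.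
- move=> x y /generatedT [z Ez] /generatedT [w Ew]; apply/generatedT.
  exists (fun i => z i + w i); rewrite /factorizations /= Ez Ew -big_split /=.
  by apply: eq_bigr => i _; rewrite mulnDl.
set a0 := mult g.+1 g'.+1.
have M0 : 0 < mers g.+1 by apply: mers_gt0.
have M0' : 0 < mers g'.+1 by apply: mers_gt0.
have co2 : coprime (mers g'.+1) (2 * mers g.+1).
  by rewrite coprimeMr [coprime _ (mers g.+1)]coprime_sym co andbT coprimen2 odd_mers.
have W r : {w | semi g g' w /\ w = r %[mod a0]}.
  apply: cid; have [V [V' [T E]]] := weight_surj _ _ r M0' M0 co2.
  have P : weight 1 2 g.+1 g'.+1 (first_vec V) (first_vec V') = r + T * a0.
    by rewrite /weight !bval_first mul1n.
  exists (a0 * (0 + g'.+2 * V + 3 * V') + a0.+1 * (r + T * a0)); split.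
    by apply/semiP; exists 0, (first_vec V), (first_vec V'); rewrite /sexpansion /expansion P !len_first.
  have -> : a0 * (0 + g'.+2 * V + 3 * V') + a0.+1 * (r + T * a0) =
    (g'.+2 * V + 3 * V' + (r + T * a0) + T) * a0 + r by ring.
  by rewrite modnMDl.
apply: (@sub_finite_set _ _ `I_(\sum_(r < a0) sval (W r))); last exact: finite_II.
move=> x /= nSx; rewrite ltnNge; apply/negP => le; apply: nSx.
have a00 : 0 < a0 by rewrite /a0 /mult !muln_gt0 M0.
pose r := Ordinal (ltn_pmod x a00).
have [Sw wr] := svalP (W r); have lew : sval (W r) <= x.
  by apply: leq_trans le; rewrite (bigD1 r) //= leq_addr.
have /dvdnP [t xt] : a0 %| x - sval (W r).
  by rewrite -eqn_mod_dvd // wr /= modn_mod.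
have [z [u [v F]]] := (semiP g g' _).1 Sw.
apply/semiP; exists (z + t), u, v.
have -> : x = t * a0 + sval (W r) by rewrite -xt subnK.
by rewrite F /sexpansion /expansion -/a0; ring.
Qed.

Lemma gen_needed g g' z : 1 < g -> 1 < g' -> coprime (mers g.+1) (mers g'.+1) ->
  forall i : 'I_(g.+1 + g'.+1).+1,
  factorizations (gens g g') (gens g g' i) z -> 0 < z i.
Proof.
move=> g1 g1' co i Fz.
pose f n := z (inord n).
have zf j : z j = f j by rewrite /f inord_val.
have {}F : sexpansion g g' (gens g g' i) (f 0) (fun i => f i.+1) (fun j => f (g.+1 + j).+1).
  rewrite /sexpansion /expansion -gen_sum Fz; apply: eq_bigr => j _; by rewrite zf.
have fl := full_cost_lt g g' g1 g1'.
have pm : g'.+2 <= mult g.+1 g'.+1.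
  by apply: leq_trans (ltnW fl); rewrite /full_cost; clear; lia.
rewrite zf; case: i F {Fz} => [[|i] /= ik]; rewrite /gens /=.
  rewrite -[mult _ _]muln1 => F.
  have [|[_ _ ->] //|[_ _]] := zero_class g g' g1 g1' co 1 _ _ _ _ F.
  by rewrite addnS.
  by move: fl; rewrite /full_cost; clear; lia.
case: ltnP => ig F.
  exact: (generator_needed 1 2 g'.+2 3 g g' i _ (fun i => f i.+1) _
            erefl isT isT (ltnW g1) (ltnW g1') co isT pm ig F).
have co' : coprime (mers g'.+1) (mers g.+1) by rewrite coprime_sym.
have ig' : i - g.+1 < g'.+1 by move: ik ig; clear; lia.
have pm3 : 3 <= mult g'.+1 g.+1 by rewrite multC; move: pm g1'; clear; lia.
have {F} := expansion_swap F; rewrite multC => F.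
have := generator_needed 2 1 3 g'.+2 g' g (i - g.+1) _ (fun j => f (g.+1 + j).+1) _
  erefl isT isT (ltnW g1') (ltnW g1) co' isT pm3 ig' F.
by rewrite subnKC.
Qed.

Lemma semi_minimal g g' : 1 < g -> 1 < g' -> coprime (mers g.+1) (mers g'.+1) ->
  minimal_generators (semi g g') (gens g g').
Proof.
move=> g1 g1' co; split=> // J /properP [_ [i _ iJ]] E.
have : semi g g' (gens g g' i).
  apply/generatedT; exists (fun j => (j == i) : nat).
  rewrite /factorizations /= (bigD1 i) //= eqxx mul1n big1 ?addn0 // => j.
  by move=> /negPf ->.
rewrite -E => -[z Ez].
have := gen_needed g g' (fun j => if j \in J then z j else 0) g1 g1' co i.
rewrite (negPf iJ) => H; suff /H : factorizations (gens g g') (gens g g' i)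
  (fun j => if j \in J then z j else 0) by [].
rewrite /factorizations /= Ez big_mkcond; apply: eq_bigr => j _.
by case: ifP.
Qed.

(** * Gaps *)
Lemma supp_zero h u : len h u = 0 -> supp h u = 0.
Proof. by have := supp_len h u; lia. Qed.
Lemma supp_ones h u : (forall i, i < h -> u i = 1) -> supp h u = h.
Proof.
move=> o; rewrite bits_supp => [|i /o -> //].
by rewrite (eq_len h u (fun=> 1) o) len_ones.
Qed.

Section Gaps.
Variables g g' : nat.
Hypotheses (g1 : 1 < g) (g1' : 1 < g') (co : coprime (mers g.+1) (mers g'.+1)).
Let k := g.+1 + g'.+1.
Let zero_elt z := mult g.+1 g'.+1 * (z + full_cost g g' + (mult g.+1 g'.+1).+1).

Lemma expansion_ones z : sexpansion g g' (zero_elt z) z (fun=> 1) (fun=> 1).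
Proof.
rewrite /sexpansion /expansion /zero_elt /weight !bval_ones !len_ones /full_cost /mult; ring.
Qed.

Lemma expansion_zero y : sexpansion g g' (mult g.+1 g'.+1 * y) y (fun=> 0) (fun=> 0).
Proof. by rewrite /sexpansion /expansion /weight /len /bval !big1 // !muln0 !addn0. Qed.

Lemma L0_zero_elt z e : z <= 2 -> L0 (gens g g') (zero_elt z) e <->
  e = 1 \/ e = (0 < z) + k.
Proof.
move=> z2; rewrite L0P; split=> [[t [u [v [F ->]]]]|[->|->]].
- have [|[lu lv ->]|[ou ov tE]] := zero_class g g' g1 g1' co _ _ _ _ _ F.
  + by move: z2; clear; lia.
  + by left; rewrite /tsupp !supp_zero // addnS.
  right; have -> : z = t by move: tE; clear; lia.
  by rewrite /tsupp !supp_ones // addnA.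
- exists (z + full_cost g g' + (mult g.+1 g'.+1).+1), (fun=> 0), (fun=> 0).
  split; first exact: expansion_zero.
  by rewrite /tsupp !supp_zero /len ?big1 // addnS.
exists z, (fun=> 1), (fun=> 1); split; first exact: expansion_ones.
by rewrite /tsupp !supp_ones // addnA.
Qed.

(** L0 of this element consists of 1 and k for z = 0, and of 1 and k + 1 for
z = 1. *)
Lemma Delta0_zero_elt z : z <= 1 ->
  Delta0_semigroup (semi g g') (gens g g') (z + k.-1).
Proof.
move=> z1; have z2 : z <= 2 by apply: leq_trans z1 _.
have zE : (0 < z) = z :> nat by case: z z1 {z2} => [|[|]].
exists (zero_elt z).
  by apply/semiP; exists z, (fun=> 1), (fun=> 1); apply: expansion_ones.
exists 1, (z + k); split.
- by apply/(L0_zero_elt _ _ z2); left.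
- by apply/(L0_zero_elt _ _ z2); right; rewrite zE.
- by rewrite /k; clear; lia.
- by move=> e /(L0_zero_elt _ _ z2) [->|->]; rewrite ?zE ?ltnn ?andbF.
by rewrite /k; clear; lia.
Qed.

Hypotheses (k16 : 16 <= k) (kh : k <= 2 * g.+1 + 4) (kh' : k <= 2 * g'.+1 + 4).

(** The gap lies at a multiple of mult.  If this multiple is large, three_mers
fits and uses about half of the generators, inside the gap; otherwise zero_class
lists all the factorizations. *)
Lemma large_gap d : Delta0_semigroup (semi g g') (gens g g') d ->
  7 * k <= 8 * d -> d = k.-1 \/ d = k.
Proof.
move=> [x _ [c [c' [/L0P [zu [u [u' [Fu cE]]]] /L0P [zw [w [w' [Fw cE']]]] cc gap ->]]]] big.
have c'k : c' <= k.+1.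
  rewrite cE' /tsupp /k; have := supp_le g.+1 w; have := supp_le g'.+1 w'.
  by clear; case: (0 < zw) => /=; lia.
have n1 : c + g' + 4 < c' by move: big c'k kh k16 cc; rewrite /k; clear; lia.
have n2 : c + g + 4 < c' by move: big c'k kh' k16 cc; rewrite /k; clear; lia.
have n3 : c + 2 < g.+1 by move: big c'k kh k16 cc; rewrite /k; clear; lia.
have n4 : c + 2 < g'.+1 by move: big c'k kh' k16 cc; rewrite /k; clear; lia.
have gapF z v v' : sexpansion g g' x z v v' -> ~~ (c < tsupp g.+1 g'.+1 z v v' < c').
  by move=> F; apply: gap; apply/L0P; exists z, v, v'.
have budget r : r <= g'.+2 -> r * (2 * c + 5) <= mult g.+1 g'.+1.
  move=> rg; apply: (@leq_trans (mers g'.+1 * (3 * mers g.+1))); last by rewrite /mult; clear; lia.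
  have m := mers_ge g.+1 (ltnW g1); have m' := mers_ge g'.+1 (ltnW g1').
  apply: leq_mul; first exact: leq_trans rg m'.
  by move: n3 m; clear; lia.
have g0 := ltnW g1; have g0' := ltnW g1'.
have [z F1] := gap_only_at_zero 1 2 g'.+2 3 g g' x c c' erefl isT isT g0 g0' co n1 n2 n3 n4
  (budget _ (leqnn _)) (budget 3 (leqW g1')) gapF zw w w' zu u u' Fw
  (ltac:(by rewrite cE')) Fu (ltac:(by rewrite cE)).
have xE : x = zero_elt z by rewrite F1; exact/esym/expansion_ones.
have z2 : z <= 2.
  rewrite leqNgt; apply/negP => z3.
  have [V L Sz] := three_mersE g g1.
  have F3 : sexpansion g g' x (z - 3) (three_mers g) (fun=> 0).
    apply: (expansion_shift 0 F1).
      by rewrite /weight V !bval_ones (bval_zero g'.+1) //; ring.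
    have -> : len g'.+1 (fun=> 0) = 0 by rewrite /len big1.
    rewrite L !len_ones -[in RHS](subnK z3) mul0n addn0 muln0 addn0; ring.
  have := gapF _ _ _ F3; rewrite /tsupp Sz.
  rewrite (_ : supp g'.+1 (fun=> 0) = 0); last by rewrite supp_zero // /len big1.
  by move: n3 n2; clear; case: (0 < _) => /=; lia.
have E e : L0 (gens g g') x e -> e = 1 \/ e = (0 < z) + k by rewrite xE => /(L0_zero_elt _ _ z2).
have c1 : c = 1 \/ c = (0 < z) + k by apply: E; apply/L0P; exists zu, u, u'.
have c2 : c' = 1 \/ c' = (0 < z) + k by apply: E; apply/L0P; exists zw, w, w'.
move: c1 c2 cc n3; rewrite /k; clear; case: (0 < z) => /=; lia.
Qed.

End Gaps.

Local Open Scope ring_scope.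

Theorem theorem4p5 (R : realType) (k : nat) (hk : (16 <= k)%N) :
  exists (S : set nat) (a : 'I_k.+1 -> nat),
    [/\ numerical_semigroup S,
        minimal_generators S a &
        [set d%:R | d in Delta0_semigroup S a] `&` `[7 / 8 * k%:R, k%:R]
          = [set k%:R - 1; k%:R] :> set R].
Proof.
have [[|g] [[|g'] [kE coh kh kh']]] := coprime_halves k hk; try by exfalso; lia.
have co := coprime_mers _ _ coh isT isT.
have g1 : (1 < g)%N by lia.
have g1' : (1 < g')%N by lia.
rewrite kE in hk kh kh' *.
exists (semi g g'), (gens g g'); split.
- exact: semi_numerical.
- exact: semi_minimal.
set n := (g.+1 + g'.+1)%N in hk kh kh' *.
have predE : n%:R - 1 = n.-1%:R :> R by rewrite -subn1 natrB //; apply: leq_trans hk.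
apply/seteqP; split=> [y [[d Dd <-]] | y [->|->]].
- rewrite /= in_itv /= => /andP[lo _].
  have big : (7 * n <= 8 * d)%N by rewrite -(ler_nat R) !natrM; lra.
  by rewrite predE; have [->|->] := large_gap g g' g1 g1' co hk kh kh' d Dd big; [left | right].
- split; first by exists n.-1 => //; exact: (Delta0_zero_elt g g' g1 g1' co 0).
  rewrite /= in_itv /= gerBl ler01 andbT.
  have : 16%:R <= n%:R :> R by rewrite ler_nat.
  lra.
- split; first by exists n => //; exact: (Delta0_zero_elt g g' g1 g1' co 1).
  rewrite /= in_itv /= lexx andbT.
  have : 16%:R <= n%:R :> R by rewrite ler_nat.
  lra.
Qed.
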